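(* (1) The chain $F(t)\in C_q(L_0)$ is a stable cycle if and only if $F(t)$ is divisible by $V_q^3(t_1,\dots,t_q)$. (2) The chain $F(t)\in C_q(\mathcal{L}_0)$ is a stable cycle if and only if $F(t)$ is divisible by $V_q(t_1^3,\dots,t_q^3)$.
   Context: Everything is over $\mathbb{Q}$. $L_0$ is the Lie algebra with basis $e_i$, $i\geq0$, and bracket $[e_a,e_b]=(b-a)e_{a+b}$. $\mathcal{L}_0$ is the Lie algebra with basis $e_i$, $i\geq0$, and bracket $[e_a,e_b]=\varepsilon_{b-a}e_{a+b}$, where $\varepsilon_z=-1,0,1$ for $z\equiv-1,0,1\bmod 3$ respectively. Let $L$ be either of these algebras, and let $\mu(z)=z$ for $L=L_0$ and $\mu(z)=\varepsilon_z$ for $L=\mathcal{L}_0$. The space of chains $C_q(L)=\bigwedge^qL$ is identified with the space of antisymmetric polynomials in $t_1,\dots,t_q$ by sending $e_{i_1}\wedge\dots\wedge e_{i_q}$ to $\Delta_{(i_1,\dots,i_q)}(t_1,\dots,t_q)=\det(t_r^{i_m})_{r,m=1,\dots,q}$; thus a chain is written as an antisymmetric polynomial $F(t)=F(t_1,\dots,t_q)$. The boundary operator is $d(e_{i_1}\wedge\dots\wedge e_{i_q})=\sum_{1\leq r<s\leq q}(-1)^{r+s-1}\mu(i_s-i_r)\,e_{i_r+i_s}\wedge e_{i_1}\wedge\dots\widehat{e}_{i_r}\dots\widehat{e}_{i_s}\dots\wedge e_{i_q}$. Let $\sigma$ be the linear operator on $C_q(L)$ with $\sigma(e_{i_1}\wedge\dots\wedge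 e_{i_q})=e_{i_1+1}\wedge\dots\wedge e_{i_q+1}$ (in terms of polynomials, multiplication by $t_1\cdots t_q$). A chain $x$ is a stable cycle if $d(\sigma^rx)=0$ for all $r\geq0$. $V_q(t_1,\dots,t_q)=\prod_{q\geq i>j\geq1}(t_i-t_j)$ is the Vandermonde determinant. *)

(* Defs.v *)
From mathcomp Require Export all_boot all_order all_fingroup all_algebra.
From mathcomp Require Export mpoly.

Set Implicit Arguments.
Unset Strict Implicit.
Unset Printing Implicit Defensive.

Import GRing.Theory.

Local Open Scope ring_scope.

(* Structure constants of L_0 and of \mathcal{L}_0, both of which have basis
   (e_i) for i >= 0 and bracket [e_a, e_b] = mu (b - a) e_{a+b}. *)
Definition mu_L0 (z : int) : int := z.

Definition mu_calL0 (z : int) : int :=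
  if (z == 1 %[mod 3])%Z then 1 else if (z == -1 %[mod 3])%Z then -1 else 0.

(* C_q(L), seen as the space of antisymmetric polynomials in q variables over
   rat; q = 0 is allowed, and boundary is then the zero map. *)
Definition is_chain (q : nat) (F : {mpoly rat[q]}) : Prop :=
  forall s : 'S_q, msym s F = (-1) ^+ odd_perm s *: F.

(* The exterior product of e_{I_0}, ..., e_{I_{q-1}} for a sequence I of
   length q, as the polynomial Delta_I. *)
Definition wedge (q : nat) (I : seq nat) : {mpoly rat[q]} :=
  \det (\matrix_(r < q, m < q) 'X_r ^+ nth 0%N I m).

(* The formula for d on the exterior product of the e_{I_k}. Positions start
   at 0 here, so that the sign (-1)^(r+s-1) becomes (-1)^(r+s+1). *)
Definition boundary_wedge (mu : int -> int) (q : nat) (I : seq nat) :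
    {mpoly rat[q.-1]} :=
  let i k := nth 0%N I k in
  \sum_(r < q) \sum_(s < q | (r < s)%N)
    ((-1) ^+ (r + s + 1) * (mu ((i s)%:Z - (i r)%:Z))%:~R) *:
      wedge q.-1 ((i r + i s)%N ::
        [seq i k | k <- iota 0 q & (k != r :> nat) && (k != s :> nat)]).

(* The wedges of strictly increasing sequences form a basis of C_q(L), and the
   coordinate of a chain F on the wedge of m is the coefficient F@_m
   (chain_wedgeE); d is the linear extension of its values on that basis
   (boundary_is_linear, boundary_wedgeE). *)
Definition boundary (mu : int -> int) (q : nat) (F : {mpoly rat[q]}) :
    {mpoly rat[q.-1]} :=
  \sum_(m <- msupp F | sorted ltn m) F@_m *: boundary_wedge mu q m.

Definition sigma (q : nat) (F : {mpoly rat[q]}) : {mpoly rat[q]} :=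
  (\prod_(i < q) 'X_i) * F.

Definition stable_cycle (mu : int -> int) (q : nat) (F : {mpoly rat[q]}) :
    Prop :=
  forall r : nat, boundary mu (iter r (@sigma q) F) = 0.

Definition vandermonde (q : nat) (t : 'I_q -> {mpoly rat[q]}) :
    {mpoly rat[q]} :=
  \prod_(i < q) \prod_(j < q | (j < i)%N) (t i - t j).

Lemma wedge_is_chain (q : nat) (I : seq nat) : is_chain (wedge q I).
Proof.
move=> s; rewrite /wedge.
set M := (X in \det X).
have -> : msym s (\det M) = \det (row_perm s M).
  rewrite -det_map_mx; congr (\det _); apply/matrixP => i j.
  by rewrite !mxE rmorphXn /= /msym mmapX mmap1U.
rewrite row_permE det_mulmx det_perm -mul_mpolyC rmorphXn /=.
by rewrite mpolyCN mpolyC1.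
Qed.

Lemma mcoeff_wedge (q : nat) (m n : 'X_{1..q}) :
  sorted ltn m -> sorted ltn n -> (wedge q m)@_n = (m == n)%:R.
Proof.
move=> sm sn; rewrite /wedge /determinant.
have mon (s : 'S_q) :
    \prod_i (\matrix_(r < q, k < q) 'X_r ^+ nth 0%N m k) i (s i)
    = 'X_[[multinom m (s i) | i < q]] :> {mpoly rat[q]}.
  rewrite mpolyXE_id; apply: eq_bigr => i _.
  by rewrite mxE mnmE (mnm_nth 0%N).
under eq_bigr => s _ do rewrite mon.
have coef (s : 'S_q) : ((-1) ^+ s * 'X_[[multinom m (s i) | i < q]])@_n
    = (-1) ^+ s * ([multinom m (s i) | i < q] == n)%:R :> rat.
  have -> : (-1) ^+ s = ((-1) ^+ s : rat)%:MP :> {mpoly rat[q]}.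
    by rewrite rmorphXn /= mpolyCN mpolyC1.
  by rewrite mul_mpolyC mcoeffZ mcoeffX.
rewrite raddf_sum /=.
under eq_bigr => s _ do rewrite coef.
have um : uniq m by move: sm; rewrite ltn_sorted_uniq_leq => /andP[].
have eq_mn (s : 'S_q) : [multinom m (s i) | i < q] = n -> m = n.
  move=> E; apply/val_inj/val_inj/(sorted_eq leq_trans anti_leq).
  - by move: sm; rewrite ltn_sorted_uniq_leq => /andP[].
  - by move: sn; rewrite ltn_sorted_uniq_leq => /andP[].
  rewrite perm_sym; apply/tuple_permP; exists s.
  by rewrite -E.
case: (eqVneq m n) => [<-|nmn]; last first.
  rewrite big1 // => s _; case: eqP => [/eq_mn/eqP|_]; last by rewrite mulr0.
  by rewrite (negPf nmn).
rewrite (bigD1 (1%g : 'S_q)) //= big1 ?addr0 => [|s ns].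
  rewrite odd_perm1 expr0 mul1r; congr (_%:R); apply/eqP.
  by rewrite eqb1; apply/eqP/mnmP => i; rewrite mnmE perm1.
case: eqP => [E|_]; last by rewrite mulr0.
case/eqP: ns; apply/permP => i; rewrite perm1; apply/val_inj/eqP.
have := congr1 (fun k : 'X_{1..q} => k i) E.
rewrite mnmE !(mnm_nth 0%N) => /eqP.
by rewrite nth_uniq // size_tuple.
Qed.

Lemma chain_eq0 (q : nat) (F : {mpoly rat[q]}) : is_chain F ->
  (forall m : 'X_{1..q}, sorted ltn m -> F@_m = 0) -> F = 0.
Proof.
move=> cF F0; apply/mpolyP => n; rewrite mcoeff0.
have swap (s : 'S_q) : F@_[multinom n (s i) | i < q] = (-1) ^+ s * F@_n.
  by rewrite -mcoeff_sym cF mcoeffZ.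
have [un|/(uniqPn 0%N)[i [j [ij]]]] := boolP (uniq n).
  have /tuple_permP[s Es] : perm_eq (sort leq n) n by rewrite perm_sort.
  have := swap s; rewrite F0 => [/esym/eqP|].
    by rewrite mulf_eq0 signr_eq0 /= => /eqP.
  have -> : [multinom n (s i) | i < q] = sort leq n :> seq nat by rewrite Es.
  by rewrite ltn_sorted_uniq_leq sort_uniq un sort_sorted //; exact: leq_total.
rewrite size_tuple => jq E.
have iq := ltn_trans ij jq.
have := swap (tperm (Ordinal iq) (Ordinal jq)); rewrite odd_tperm.
have -> : [multinom n (tperm (Ordinal iq) (Ordinal jq) k) | k < q] = n.
  apply/mnmP => k; rewrite mnmE.
  by case: tpermP => [->|->|_ _] //; rewrite !(mnm_nth 0%N) /= E.
rewrite -val_eqE /= (ltn_eqF ij) /= expr1 mulN1r => /eqP.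
by rewrite -addr_eq0 -mulr2n Num.Theory.mulrn_eq0 /= => /eqP.
Qed.

Lemma chain_wedgeE (q : nat) (F : {mpoly rat[q]}) : is_chain F ->
  F = \sum_(m <- msupp F | sorted ltn m) F@_m *: wedge q m.
Proof.
move=> cF; apply/eqP; rewrite -subr_eq0; apply/eqP/chain_eq0 => [s|n sn].
  rewrite msymB cF scalerBr; congr (_ - _); rewrite (linear_sum (msym s)).
  rewrite scaler_sumr; apply: eq_bigr => m _.
  by rewrite linearZ /= wedge_is_chain !scalerA mulrC.
rewrite mcoeffB raddf_sum /=.
rewrite (eq_bigr (fun m => if m == n then F@_n else 0)); last first.
  move=> m sm; rewrite mcoeffZ mcoeff_wedge //.
  by case: eqP => [->|_]; rewrite ?mulr1 ?mulr0.
rewrite -big_mkcondr /= (eq_bigl (pred1 n)) => [|m /=]; last first.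
  by case: eqP => [->|_]; rewrite ?sn ?andbF.
have [nF|/[dup] nF /memN_msupp_eq0 ->] := boolP (n \in msupp F).
  by rewrite -big_filter filter_pred1_uniq ?msupp_uniq // big_seq1 subrr.
by rewrite big1 ?subrr.
Qed.

Lemma boundary_supp (mu : int -> int) (q : nat) (F : {mpoly rat[q]})
    (r : seq 'X_{1..q}) : uniq r -> {subset msupp F <= r} ->
  boundary mu F = \sum_(m <- r | sorted ltn m) F@_m *: boundary_wedge mu q m.
Proof.
move=> ur sub; rewrite [RHS](bigID (mem (msupp F))) /= [X in _ + X]big1 ?addr0.
  under eq_bigl => m do rewrite andbC.
  rewrite -big_filter_cond; apply: perm_big; apply: uniq_perm.
  - exact: msupp_uniq.
  - exact: filter_uniq.
  by move=> m; rewrite mem_filter; case: (boolP (m \in msupp F)) => // /sub ->.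
by move=> m /andP[_ /memN_msupp_eq0 ->]; rewrite scale0r.
Qed.

Lemma boundary_is_linear (mu : int -> int) (q : nat) (a : rat)
    (F G : {mpoly rat[q]}) :
  boundary mu (a *: F + G) = a *: boundary mu F + boundary mu G.
Proof.
pose r := undup (msupp F ++ msupp G ++ msupp (a *: F + G)).
rewrite !(@boundary_supp mu q _ r) ?undup_uniq // => [||m|m]; first last.
- by rewrite mem_undup !mem_cat => ->; rewrite !orbT.
- by rewrite mem_undup !mem_cat => ->.
- by move=> m; rewrite mem_undup !mem_cat => ->; rewrite !orbT.
rewrite scaler_sumr -big_split; apply: eq_bigr => m _.
by rewrite mcoeffD mcoeffZ scalerDl scalerA.
Qed.

Lemma boundary_wedgeE (mu : int -> int) (q : nat) (I : seq nat) :
  size I = q -> sorted ltn I ->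
  boundary mu (wedge q I) = boundary_wedge mu q I.
Proof.
move=> sI; have tI : size I == q by apply/eqP.
pose m : 'X_{1..q} := Multinom (Tuple tI).
rewrite -[I]/(m : seq nat) => sm.
have [r [ur mr sub]] : exists r : seq 'X_{1..q},
    [/\ uniq r, m \in r & {subset msupp (wedge q m) <= r}].
  exists (undup (m :: msupp (wedge q m))).
  split=> [||n nm]; first exact: undup_uniq.
    by rewrite mem_undup mem_head.
  by rewrite mem_undup inE nm orbT.
rewrite (boundary_supp mu ur sub).
rewrite (eq_bigr (fun n => if n == m then boundary_wedge mu q m else 0)).
  rewrite -big_mkcondr /= (eq_bigl (pred1 m)) => [|n /=]; last first.
    by case: eqP => [->|_]; rewrite ?sm ?andbF.
  by rewrite -big_filter filter_pred1_uniq // big_seq1.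
move=> n sn; rewrite mcoeff_wedge // eq_sym.
by case: eqP => [->|_]; rewrite ?scale1r ?scale0r.
Qed.

Lemma sigma_wedge (q : nat) (I : seq nat) : size I = q ->
  sigma (wedge q I) = wedge q (map succn I).
Proof.
move=> sI; rewrite /sigma /wedge.
set M := (X in \det X).
have -> : \prod_(i < q) 'X_i = \det (diag_mx (\row_(i < q) 'X_i))
    :> {mpoly rat[q]}.
  by rewrite det_diag; apply: eq_bigr => i _; rewrite mxE.
rewrite -det_mulmx; congr (\det _); apply/matrixP => i j.
by rewrite mul_diag_mx !mxE (nth_map 0%N) ?sI // exprS.
Qed.

(* Main.v *)
From HB Require Import structures.
Require Import Defs.
From mathcomp Require Import ssrnum algC cyclotomic ring lra.

Set Implicit Arguments.
Unset Strict Implicit.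
Unset Printing Implicit Defensive.

Import GRing.Theory.
Local Open Scope ring_scope.

(** Let [W] multiply each monomial by [mu] of the difference of its exponents
    at the variables 1 and 0, and let [merge k] identify these two variables
    with the variable [k] of the q - 1 variables of the target. Laplace
    expansion along the rows of the variables 0 and 1 shows that, for a chain
    [F], twice the boundary of [F] is the alternating sum over [k] of
    [merge k (W F)] ([boundary_merge]). Multiplication by the product of all
    variables commutes with [W], and [merge k] sends this product to ['X_k]
    times the product of all variables of the target. Hence [F] is a stable cycle
    iff the sums of [(-1) ^ k 'X_k ^ r merge k (W F)] vanish for all [r], that
    is, as the ['X_k] are distinct elements of a domain, iff every
    [merge k (W F)] vanishes ([stable_cycle_mergeP]).

    When [mu z = z], [W] is the derivation which maps ['X_1] to itself, ['X_0]
    to its opposite and the other variables to 0. An antisymmetric [F] is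
    divisible by [p = 'X_1 - 'X_0]; the vanishing of [W F] at ['X_1 = 'X_0]
    makes it divisible by [p ^ 2], and antisymmetry again by [p ^ 3].

    When [mu z] is the residue -1, 0 or 1 of [z] modulo 3, it is proportional to
    [c ^ z - c ^ (- z)] for a primitive cube root of unity [c], so that
    [merge k (W F)] is proportional to the difference of the values of [F] at
    two points which are exchanged by the transposition of the variables 0
    and 1; for antisymmetric [F] it vanishes iff [F] does when
    ['X_1 = c ^ 2 'X_0], up to rescaling. Over the rationals this means
    divisibility by ['X_1 ^ 2 + 'X_1 'X_0 + 'X_0 ^ 2], and together with
    antisymmetry divisibility by ['X_1 ^ 3 - 'X_0 ^ 3].

    By antisymmetry the same divisibility holds for all pairs of variables.
    The factors belonging to distinct pairs are coprime, because the prime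
    factors of each generate the kernels of substitutions ['X_i := c 'X_j] under
    which the factors of the other pairs do not vanish; hence the product of all of them divides [F]
    ([rdvd_chain_prod]). *)

(** * Polynomials and substitutions *)

Section Polynomials.

Variables (K : comNzRingType) (n : nat).
Implicit Types F G : {mpoly K[n]}.

Lemma mpoly_ring_ind (P : {mpoly K[n]} -> Prop) :
    (forall c, P c%:MP) -> (forall F G, P F -> P G -> P (F + G)) ->
    (forall i F, P F -> P ('X_i * F)) ->
  forall F, P F.
Proof.
move=> PC PD PX F; rewrite [F]mpolyE; elim/big_ind: _ => // [|m _].
  by rewrite -mpolyC0; apply: PC.
rewrite -mul_mpolyC mulrC mpolyXE_id -big_enum.
elim: (enum _) => [|i r IHr]; rewrite ?big_nil ?mul1r ?big_cons -?mulrA //.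
by elim: (m i) => [|k IHk]; rewrite ?mul1r // exprS -mulrA; apply: PX.
Qed.

Lemma mpoly_rmorph_eq (S : nzRingType) (f g : {rmorphism {mpoly K[n]} -> S}) :
    (forall c, f c%:MP = g c%:MP) -> (forall i, f 'X_i = g 'X_i) -> f =1 g.
Proof.
move=> fgC fgX; apply: mpoly_ring_ind => // [F G eF eG | i F eF].
  by rewrite !rmorphD eF eG.
by rewrite !rmorphM fgX eF.
Qed.

Lemma mpoly_monomial_ind (P : {mpoly K[n]} -> Prop) :
    (forall F G, P F -> P G -> P (F + G)) -> (forall c m, P (c *: 'X_[m])) ->
  forall F, P F.
Proof.
move=> PD PX F; rewrite [F]mpolyE; elim/big_ind: _ => // [].
by rewrite -(scale0r 'X_[0%MM]).
Qed.

End Polynomials.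

(** Substitution of polynomials for the variables. *)
Definition msubst (K : comNzRingType) n p (t : 'I_n -> {mpoly K[p]}) :
    {mpoly K[n]} -> {mpoly K[p]} :=
  mmap (@mpolyC p K) t.

HB.instance Definition _ (K : comNzRingType) n p (t : 'I_n -> {mpoly K[p]}) :=
  GRing.RMorphism.copy (msubst t) (mmap (@mpolyC p K) t).

(** Substitution after extension of the scalars to the algebraic numbers. *)
Definition Csubst n p (t : 'I_n -> {mpoly algC[p]}) :
    {mpoly rat[n]} -> {mpoly algC[p]} :=
  mmap (@mpolyC p algC \o ratr) t.

HB.instance Definition _ n p (t : 'I_n -> {mpoly algC[p]}) :=
  GRing.RMorphism.copy (Csubst t) (mmap (@mpolyC p algC \o ratr) t).

Lemma msubstX (K : comNzRingType) n p (t : 'I_n -> {mpoly K[p]}) i :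
  msubst t 'X_i = t i.
Proof. by rewrite /msubst mmapX mmap1U. Qed.

Lemma msubstC (K : comNzRingType) n p (t : 'I_n -> {mpoly K[p]}) c :
  msubst t c%:MP = c%:MP.
Proof. by rewrite /msubst mmapC. Qed.

Lemma CsubstX n p (t : 'I_n -> {mpoly algC[p]}) i : Csubst t 'X_i = t i.
Proof. by rewrite /Csubst mmapX mmap1U. Qed.

Lemma CsubstC n p (t : 'I_n -> {mpoly algC[p]}) c :
  Csubst t c%:MP = (ratr c)%:MP.
Proof. by rewrite /Csubst mmapC. Qed.

(** * Divisibility by products *)

Section Divisibility.

Variable R : idomainType.
Implicit Types a b F G : R.

(** Divisibility of [F] by [a]. *)
Definition rdvd a F := exists G, F = G * a.

Lemma rdvd_mull a F G : rdvd a F -> rdvd a (G * F).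
Proof. by case=> Q ->; exists (G * Q); rewrite mulrA. Qed.

Lemma rdvd_mulr a F G : rdvd a F -> rdvd a (F * G).
Proof. by rewrite mulrC; apply: rdvd_mull. Qed.

Lemma rdvdD a F G : rdvd a F -> rdvd a G -> rdvd a (F + G).
Proof. by case=> Q -> [Q' ->]; exists (Q + Q'); rewrite mulrDl. Qed.

(** Multiplication by [a] is injective modulo [b]. In a factorial domain, with
    [b] nonzero, this says that [a] and [b] are coprime; this form needs no
    greatest common divisors. *)
Definition regular_mod a b := forall G, rdvd b (a * G) -> rdvd b G.

Lemma regular_mod_mull a a' b :
  regular_mod a b -> regular_mod a' b -> regular_mod (a * a') b.
Proof. by move=> ab a'b G; rewrite -mulrA => /ab/a'b. Qed.

Lemma regular_mod_mulr a b b' : b != 0 ->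
  regular_mod a b -> regular_mod a b' -> regular_mod a (b * b').
Proof.
move=> b0 ab ab' G [Q EQ].
have [|G' EG] := ab G; first by exists (Q * b'); rewrite EQ; ring.
have [|G2 EG2] := ab' G'; last by exists G2; rewrite EG EG2; ring.
by exists Q; apply: (mulIf b0); rewrite -mulrA -EG EQ; ring.
Qed.

Lemma rdvd_prod (I : eqType) (r : seq I) (b : I -> R) F : uniq r ->
    {in r &, forall k l, k != l -> regular_mod (b k) (b l)} ->
    {in r, forall k, rdvd (b k) F} ->
  rdvd (\prod_(k <- r) b k) F.
Proof.
elim: r F => [|k r IHr] F /=.
  by move=> _ _ _; exists F; rewrite big_nil mulr1.
case/andP=> kr ur reg dv; rewrite big_cons.
have [|Q EQ] := dv k; first exact: mem_head.
have [//|l l' lr l'r|l lr|G EG] := IHr Q.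
- by apply: reg; rewrite inE ?lr ?l'r orbT.
- apply: (reg k l); rewrite ?inE ?eqxx ?lr ?orbT //.
    by apply: contraNneq kr => ->.
  by rewrite mulrC -EQ; apply: dv; rewrite inE lr orbT.
by exists G; rewrite EQ EG; ring.
Qed.

(** If the kernel of a morphism to a domain consists of the multiples of [p],
    then [p] is prime or zero, and an element outside the kernel is regular
    modulo [p]. *)
Lemma regular_mod_ker (S : idomainType) (f : {rmorphism R -> S}) a p :
    f p = 0 -> (forall F, f F = 0 -> rdvd p F) -> f a != 0 ->
  regular_mod a p.
Proof.
move=> fp0 kerf fa0 G [Q EQ]; apply: kerf; apply/eqP.
by rewrite -(mulrI_eq0 _ (mulfI fa0)) -rmorphM EQ rmorphM fp0 mulr0.
Qed.

End Divisibility.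

(** * The factors of the Vandermonde products *)

Lemma mpolyXn_sub_neq0 (R : nzRingType) n (k l : 'I_n) d : (0 < d)%N ->
  k != l -> 'X_k ^+ d - 'X_l ^+ d != 0 :> {mpoly R[n]}.
Proof.
move=> d0 kl; apply/eqP => /(congr1 (mcoeff (U_(k) *+ d)%MM)).
rewrite mcoeffB !mcoeffXn eqxx mcoeff0.
have -> : (U_(l) *+ d == U_(k) *+ d)%MM = false.
  apply/eqP => /mnmP/(_ k)/eqP; rewrite !mulmnE !mnm1E eqxx.
  rewrite [l == k]eq_sym (negPf kl).
  by rewrite mul0n mul1n eq_sym -leqn0 leqNgt d0.
by rewrite subr0 => /eqP; rewrite oner_eq0.
Qed.

Section Factors.

Variables (q : nat) (i j : 'I_q).
Implicit Types F : {mpoly rat[q]}.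

(** The index map underlying the substitution of ['X_j] for ['X_i]. *)
Definition collapse_idx (k : 'I_q) := if k == i then j else k.

Lemma collapse_idx_neq (k l : 'I_q) : (j < i)%N -> (l < k)%N ->
  (k, l) != (i, j) -> collapse_idx k != collapse_idx l.
Proof.
rewrite /collapse_idx => ji.
case: (eqVneq k i) => [-> | ki]; case: (eqVneq l i) => [El | li] //.
- by rewrite El ltnn.
- by rewrite xpair_eqE eqxx eq_sym.
- by rewrite El => ik _; rewrite neq_ltn (ltn_trans ji ik) orbT.
by move=> lk _; rewrite neq_ltn lk orbT.
Qed.

(** The substitution ['X_i := 'X_j]. *)
Definition collapse : {mpoly rat[q]} -> {mpoly rat[q]} :=
  msubst (fun k => 'X_(collapse_idx k)).

HB.instance Definition _ := GRing.RMorphism.on collapse.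

Lemma rdvd_sub_collapse F : rdvd ('X_i - 'X_j) (F - collapse F).
Proof.
elim/mpoly_ring_ind: F => [c | F G FP GP | k F FP].
- by rewrite /collapse msubstC subrr; exists 0; rewrite mul0r.
- by rewrite rmorphD opprD addrACA; exact: (rdvdD FP GP).
rewrite rmorphM /= {1}/collapse msubstX /collapse_idx.
have -> T : 'X_k * F - T * collapse F =
  'X_k * (F - collapse F) + ('X_k - T) * collapse F by ring.
apply: rdvdD; first exact: rdvd_mull.
apply: rdvd_mulr; case: eqP => [->|_]; first by exists 1; rewrite mul1r.
by rewrite subrr; exists 0; rewrite mul0r.
Qed.

Lemma rdvd_collapse F : collapse F = 0 -> rdvd ('X_i - 'X_j) F.
Proof. by move=> F0; have := rdvd_sub_collapse F; rewrite F0 subr0. Qed.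

(** The substitution ['X_i := c 'X_j] with [c] algebraic. *)
Definition Ccollapse (c : algC) : {mpoly rat[q]} -> {mpoly algC[q]} :=
  Csubst (fun k => if k == i then c *: 'X_j else 'X_k).

HB.instance Definition _ c := GRing.RMorphism.on (Ccollapse c).

(** The homogeneous third cyclotomic polynomial in ['X_i] and ['X_j]. *)
Definition cyclo3 : {mpoly rat[q]} := 'X_i ^+ 2 + 'X_i * 'X_j + 'X_j ^+ 2.

(** For [i != j], this is division by [cyclo3], which is monic of degree 2 in
    ['X_i]; the polynomials free of ['X_i] form the image of [collapse]. *)
Lemma cyclo3_rem F :
  exists Q A B, F = Q * cyclo3 + collapse A + 'X_i * collapse B.
Proof.
elim/mpoly_ring_ind: F => [c | F G | k F].
- exists 0, c%:MP, 0; rewrite mul0r rmorph0 mulr0 addr0 add0r.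
  by rewrite /collapse msubstC.
- move=> [Q [A [B ->]]] [Q' [A' [B' ->]]].
  exists (Q + Q'), (A + A'), (B + B'); rewrite !rmorphD /=.
  move: (collapse A) (collapse A') (collapse B) (collapse B') => a a' b b'.
  by ring.
move=> [Q [A [B ->]]]; case: (eqVneq k i) => [->|ki].
  exists ('X_i * Q + collapse B), (- 'X_j ^+ 2 * B), (A - 'X_j * B).
  have cXj : collapse 'X_j = 'X_j.
    by rewrite /collapse msubstX /collapse_idx; case: eqP.
  rewrite rmorphB !rmorphM rmorphN rmorphXn /= cXj /cyclo3.
  by move: (collapse A) (collapse B) => a b; ring.
exists ('X_k * Q), ('X_k * A), ('X_k * B).
have cXk : collapse 'X_k = 'X_k.
  by rewrite /collapse msubstX /collapse_idx (negPf ki).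
rewrite !rmorphM /= cXk.
by move: (collapse A) (collapse B) => a b; ring.
Qed.

Section CubeRoot.

Variable c : algC.
Hypothesis c3 : c ^+ 2 + c + 1 = 0.

Lemma cube_root_indep (a b : rat) : ratr a + c * ratr b = 0 -> a = 0 /\ b = 0.
Proof.
move=> E; have [b0|b0] := eqVneq b 0.
  move: E; rewrite b0 rmorph0 mulr0 addr0 => /eqP.
  by rewrite fmorph_eq0 => /eqP.
have cE : c = ratr (- a / b).
  rewrite rmorphM fmorphV rmorphN /=.
  apply: (canRL (mulfK _)); first by rewrite fmorph_eq0.
  by apply/eqP; rewrite -addr_eq0 addrC E.
move: c3; rewrite cE -rmorphXn -(rmorph1 (@ratr algC)) -!rmorphD => /eqP.
by rewrite fmorph_eq0 => /eqP; nra.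
Qed.

Lemma cube_root_cube : c ^+ 3 = 1.
Proof. by rewrite -[RHS]addr0 -[in RHS](mulr0 (c - 1)) -c3; ring. Qed.

Lemma Ccollapse_cyclo3 : i != j -> Ccollapse c cyclo3 = 0.
Proof.
rewrite eq_sym => ij; rewrite /cyclo3 !(rmorphD, rmorphM, rmorphXn) /=.
rewrite /Ccollapse !CsubstX eqxx (negPf ij) -!mul_mpolyC.
transitivity ((c ^+ 2 + c + 1)%:MP * 'X_j ^+ 2 : {mpoly algC[q]}).
  by rewrite !rmorphD rmorphXn rmorph1 /=; ring.
by rewrite c3 rmorph0 mul0r.
Qed.

(** After division by [cyclo3], the remainder [A + 'X_i B] with [A] and [B] free
    of ['X_i] goes to [A + c 'X_j B], and 1 and [c] are linearly independent
    over the rationals. *)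
Lemma rdvd_Ccollapse F : i != j -> Ccollapse c F = 0 -> rdvd cyclo3 F.
Proof.
move=> ij; have [Q [A [B ->]]] := cyclo3_rem F.
have CC G : Ccollapse c (collapse G) = map_mpoly ratr (collapse G).
  apply: (@mpoly_rmorph_eq _ _ _ (Ccollapse c \o collapse)
           (map_mpoly ratr \o collapse)) => [a | k] /=.
    by rewrite /collapse !msubstC /Ccollapse CsubstC map_mpolyC.
  rewrite /collapse !msubstX /Ccollapse CsubstX map_mpolyX /collapse_idx.
  by case: (eqVneq k i) => [_|/negPf->//]; rewrite eq_sym (negPf ij).
have CXi : Ccollapse c 'X_i = c%:MP * map_mpoly ratr 'X_j.
  by rewrite /Ccollapse CsubstX eqxx map_mpolyX mul_mpolyC.
rewrite !rmorphD !rmorphM /= Ccollapse_cyclo3 // mulr0 add0r !CC CXi.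
rewrite -mulrA -rmorphM /= => E.
have {}E m : (collapse A)@_m = 0 /\ ('X_j * collapse B)@_m = 0.
  apply: cube_root_indep; rewrite -!mcoeff_map_mpoly -mcoeffCM -mcoeffD E.
  by rewrite mcoeff0.
have -> : collapse A = 0.
  by apply/mpolyP => m; rewrite mcoeff0; case: (E m).
have /eqP : 'X_j * collapse B = 0.
  by apply/mpolyP => m; rewrite mcoeff0; case: (E m).
rewrite mulf_eq0 => /orP[/eqP Xj0|/eqP ->].
  have := mcoeffXU rat j j; rewrite Xj0 mcoeff0 eqxx => /esym/eqP.
  by rewrite oner_eq0.
by rewrite mulr0 !addr0; exists Q.
Qed.

Lemma Ccollapse_cube k :
  Ccollapse c ('X_k ^+ 3) = 'X_(collapse_idx k) ^+ 3.
Proof.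
rewrite rmorphXn /= /Ccollapse CsubstX /collapse_idx.
by case: eqP => // _; rewrite exprZn cube_root_cube scale1r.
Qed.

End CubeRoot.

Lemma cube_sub_factor :
  'X_i ^+ 3 - 'X_j ^+ 3 = ('X_i - 'X_j) * cyclo3 :> {mpoly rat[q]}.
Proof. by rewrite /cyclo3; ring. Qed.

Lemma collapseX k : collapse 'X_k = 'X_(collapse_idx k).
Proof. exact: msubstX. Qed.

Lemma collapse_sub : i != j -> collapse ('X_i - 'X_j) = 0.
Proof.
by rewrite rmorphB /= !collapseX /collapse_idx eqxx eq_sym => /negPf->;
   rewrite subrr.
Qed.

End Factors.

Lemma cube_root_exists : exists c : algC, c ^+ 2 + c + 1 = 0.
Proof.
have [c pc] := C_prim_root_exists (isT : (0 < 3)%N); exists c.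
have c1 : c - 1 != 0.
  by rewrite subr_eq0 -(expr1 c) -(prim_order_dvd pc).
apply: (mulfI c1); rewrite mulr0.
by transitivity (c ^+ 3 - 1); [ring | rewrite prim_expr_order // subrr].
Qed.

Section RegularFactors.

Variables (q : nat) (i j k l : 'I_q).
Hypotheses (ji : (j < i)%N) (lk : (l < k)%N) (klij : (k, l) != (i, j)).

Let ij : i != j. Proof. by rewrite neq_ltn ji orbT. Qed.

Lemma regular_mod_sub d : (0 < d)%N ->
  regular_mod ('X_k ^+ d - 'X_l ^+ d) ('X_i - 'X_j : {mpoly rat[q]}).
Proof.
move=> d0; apply: (@regular_mod_ker _ _ (collapse i j)).
- exact: collapse_sub.
- exact: rdvd_collapse.
rewrite rmorphB !rmorphXn /= !collapseX mpolyXn_sub_neq0 //.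
exact: collapse_idx_neq.
Qed.

Lemma regular_mod_sub_cube :
  regular_mod (('X_k - 'X_l) ^+ 3) (('X_i - 'X_j) ^+ 3 : {mpoly rat[q]}).
Proof.
have reg := regular_mod_sub (isT : (0 < 1)%N); rewrite !expr1 in reg.
have nz : 'X_i - 'X_j != 0 :> {mpoly rat[q]}.
  by have := mpolyXn_sub_neq0 rat (isT : (0 < 1)%N) ij; rewrite !expr1.
rewrite ![_ ^+ 3]exprS !expr2.
by do ?[apply: regular_mod_mull | apply: regular_mod_mulr].
Qed.

Lemma regular_mod_cube_sub :
  regular_mod ('X_k ^+ 3 - 'X_l ^+ 3) ('X_i ^+ 3 - 'X_j ^+ 3 : {mpoly rat[q]}).
Proof.
have nz : 'X_i - 'X_j != 0 :> {mpoly rat[q]}.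
  by have := mpolyXn_sub_neq0 rat (isT : (0 < 1)%N) ij; rewrite !expr1.
rewrite (cube_sub_factor i j); apply: regular_mod_mulr => //.
  exact: regular_mod_sub.
have [c c3] := cube_root_exists.
apply: (@regular_mod_ker _ _ (Ccollapse i j c)).
- exact: Ccollapse_cyclo3.
- by move=> F; apply: rdvd_Ccollapse.
rewrite rmorphB /= !Ccollapse_cube // mpolyXn_sub_neq0 //.
exact: collapse_idx_neq.
Qed.

End RegularFactors.

(** * The boundary as an alternating sum of merged chains *)

Lemma sum_sym_ltn (V : zmodType) N (H : nat -> nat -> V) :
    (forall r s, H s r = H r s) -> (forall r, H r r = 0) ->
  \sum_(r < N) \sum_(s < N) H r s =
    (\sum_(r < N) \sum_(s < N | (r < s)%N) H r s) *+ 2.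
Proof.
move=> Hsym Hdiag; rewrite mulr2n.
under [LHS]eq_bigr => r _ do rewrite (bigID (fun s : 'I_N => r < s)%N) /=.
rewrite big_split; congr (_ + _).
rewrite [RHS](exchange_big_dep xpredT) //=; apply: eq_bigr => r _.
rewrite (bigID (pred1 r)) /= big1 ?add0r => [|s /andP[_ /eqP->] //].
by apply: eq_big => s; rewrite // -leqNgt ltn_neqAle andbC.
Qed.

Section Boundary.

Variables (mu : int -> int) (n : nat).

Let i1 : 'I_n.+2 := lift ord0 ord0.

Definition weight_mnm (m : 'X_{1..n.+2}) : rat :=
  (mu ((m i1)%:Z - (m ord0)%:Z))%:~R.

(** The diagonal operator which multiplies each monomial by [mu] of the
    difference of its exponents at the variables 1 and 0. *)
Definition weight (F : {mpoly rat[n.+2]}) : {mpoly rat[n.+2]} :=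
  \sum_(m <- msupp F) (F@_m * weight_mnm m) *: 'X_[m].

Lemma mcoeff_weight F m : (weight F)@_m = F@_m * weight_mnm m.
Proof.
rewrite /weight raddf_sum /=.
rewrite (eq_bigr (fun k => if k == m then F@_m * weight_mnm m else 0)).
  rewrite -big_mkcond /=.
  have [mF|/[dup] mF /memN_msupp_eq0 ->] := boolP (m \in msupp F).
    by rewrite -big_filter filter_pred1_uniq ?msupp_uniq // big_seq1.
  by rewrite mul0r big1.
by move=> k _; rewrite mcoeffZ mcoeffX; case: eqP => [->|_];
  rewrite ?mulr1 ?mulr0.
Qed.

Fact weight_is_linear : linear weight.
Proof.
move=> a F G; apply/mpolyP => m.
by rewrite mcoeffD mcoeffZ !mcoeff_weight mcoeffD mcoeffZ; ring.
Qed.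

HB.instance Definition _ :=
  GRing.isLinear.Build rat _ _ _ weight weight_is_linear.

Lemma weightX m : weight 'X_[m] = weight_mnm m *: 'X_[m].
Proof.
apply/mpolyP => k; rewrite mcoeff_weight mcoeffZ mcoeffX.
by case: eqP => [->|_]; rewrite ?mul1r ?mulr1 ?mul0r ?mulr0.
Qed.

(** The position of variable [l] after the variables 0 and 1 are merged into
    variable [k], the others keeping their order. *)
Definition merge_idx (k : 'I_n.+1) (l : 'I_n.+2) : 'I_n.+1 :=
  if unlift ord0 l is Some l1 then
    if unlift ord0 l1 is Some l2 then lift k l2 else k
  else k.

(** The specialization of both variables 0 and 1 to ['X_k]. *)
Definition merge (k : 'I_n.+1) : {mpoly rat[n.+2]} -> {mpoly rat[n.+1]} :=
  msubst (fun l => 'X_(merge_idx k l)).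

HB.instance Definition _ k := GRing.RMorphism.on (merge k).

Lemma mergeX k l : merge k 'X_l = 'X_(merge_idx k l).
Proof. exact: msubstX. Qed.

Lemma mergeC k c : merge k c%:MP = c%:MP.
Proof. exact: msubstC. Qed.

(** Renaming of the variables past the variables 0 and 1. *)
Definition shift2 : {mpoly rat[n]} -> {mpoly rat[n.+2]} :=
  msubst (fun l => 'X_(lift ord0 (lift ord0 l))).

HB.instance Definition _ := GRing.RMorphism.on shift2.

(** Renaming of the variables around the variable [k]. *)
Definition skip (k : 'I_n.+1) : {mpoly rat[n]} -> {mpoly rat[n.+1]} :=
  msubst (fun l => 'X_(lift k l)).

HB.instance Definition _ k := GRing.RMorphism.on (skip k).

Lemma merge_idx0 k : merge_idx k ord0 = k.
Proof. by rewrite /merge_idx unlift_none. Qed.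

Lemma merge_idx1 k : merge_idx k i1 = k.
Proof. by rewrite /merge_idx liftK unlift_none. Qed.

Lemma merge_idx2 k l : merge_idx k (lift ord0 (lift ord0 l)) = lift k l.
Proof. by rewrite /merge_idx !liftK. Qed.

Lemma merge_shift2 k P : merge k (shift2 P) = skip k P.
Proof.
move: P; apply: (@mpoly_rmorph_eq _ _ _ (merge k \o shift2) (skip k)) => [c|l].
  by rewrite /= /merge /shift2 /skip !msubstC.
by rewrite /= /merge /shift2 /skip !msubstX merge_idx2.
Qed.

Lemma weight_shift2 a b P :
  weight ('X_ord0 ^+ a * 'X_i1 ^+ b * shift2 P) =
    (mu (b%:Z - a%:Z))%:~R *: ('X_ord0 ^+ a * 'X_i1 ^+ b * shift2 P).
Proof.
rewrite [P]mpolyE rmorph_sum !mulr_sumr raddf_sum scaler_sumr /=.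
apply: eq_bigr => m _; rewrite -mul_mpolyC rmorphM /= [shift2 _%:MP]msubstC.
rewrite mulrCA mul_mpolyC linearZ /= scalerA [_ * P@_m]mulrC -scalerA.
congr (_ *: _).
have EX : shift2 'X_[m] = 'X_[\sum_l U_(lift ord0 (lift ord0 l)) *+ m l].
  rewrite /shift2 /msubst mmapX /mmap1.
  rewrite (big_morph _ (mpolyXD _) (mpolyX0 _ _)).
  by apply: eq_bigr => l _; rewrite mpolyXn.
rewrite [shift2 _]EX !mpolyXn -!mpolyXD weightX; congr (_ *: _).
rewrite /weight_mnm !mnmDE !mulmnE !mnm_sumE !big1 ?addn0 => [|l _|l _].
- by rewrite !mnm1E !eqxx /= !mul0n !mul1n addn0 add0n.
all: by rewrite mulmnE mnm1E.
Qed.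

Implicit Types I : seq nat.

(** The exponents of [I] other than those at the positions [r] and [s]. *)
Definition wedge_minor I (r s : nat) : seq nat :=
  [seq nth 0%N I k | k <- iota 0 n.+2 & (k != r :> nat) && (k != s :> nat)].

Lemma nth_wedge_minor I (r : 'I_n.+2) (s : 'I_n.+1) (l : 'I_n) :
  nth 0%N (wedge_minor I r (lift r s)) l = nth 0%N I (lift r (lift s l)).
Proof.
rewrite /wedge_minor.
have -> : [seq k <- iota 0 n.+2 | (k != r :> nat) &&
      (k != lift r s :> nat)]
    = [seq val (lift r (lift s x)) | x <- enum 'I_n].
  apply: (irr_sorted_eq ltn_trans ltnn).
  - by apply: sorted_filter; [exact: ltn_trans | exact: iota_ltn_sorted].
  - have: sorted (relpre val ltn) (enum 'I_n).
      by rewrite -sorted_map val_enum_ord iota_ltn_sorted.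
    by apply: homo_sorted => x y /= xy;
       rewrite ltnNge !leq_bump2 -ltnNge.
  move=> k; rewrite mem_filter mem_iota /= add0n.
  apply/idP/mapP => [/andP[/andP[kr ks] kn]|[x _ ->]].
    have rk : r != Ordinal kn by rewrite eq_sym.
    have [k1 Ek1 _] := unlift_some rk.
    have sk : s != k1.
      by apply: contraNneq ks => ->;
        rewrite -[bump _ _]/(val (lift r k1)) -Ek1.
    have [k2 Ek2 _] := unlift_some sk.
    exists k2; first by rewrite mem_enum.
    by rewrite -[bump _ _]/(val (lift r (lift s k2))) -Ek2 -Ek1.
  rewrite (ltn_ord (lift r (lift s x))) andbT.
  by rewrite (inj_eq (can_inj (bumpK r))) ![bump _ _ == _]eq_sym !neq_bump.
rewrite -map_comp (nth_map l) ?size_enum_ord //=.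
by rewrite nth_ord_enum.
Qed.

(** Laplace expansion along the variables 0 and 1. *)
Lemma wedge_expand2 I : wedge n.+2 I =
  \sum_(r < n.+2) \sum_(s < n.+1) (-1) ^+ (r + s) *
    ('X_ord0 ^+ nth 0%N I r * 'X_i1 ^+ nth 0%N I (lift r s)
       * shift2 (wedge n (wedge_minor I r (lift r s)))).
Proof.
rewrite /wedge (expand_det_row _ ord0); apply: eq_bigr => r _.
rewrite /cofactor (expand_det_row _ ord0) !mulr_sumr; apply: eq_bigr => s _.
rewrite /cofactor !mxE !add0n /= -det_map_mx exprD.
set M := \matrix_(_, _) _; set N := map_mx _ _.
have -> : row' ord0 (col' s (row' ord0 (col' r M))) = N.
  apply/matrixP => x y; rewrite !mxE rmorphXn /= nth_wedge_minor.
  by rewrite /shift2 msubstX.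
by rewrite -[lift ord0 ord0]/i1; ring.
Qed.

(** Laplace expansion along the first exponent. *)
Lemma wedge_expand1 a I : wedge n.+1 (a :: I) =
  \sum_(k < n.+1) (-1) ^+ k * ('X_k ^+ a * skip k (wedge n I)).
Proof.
rewrite /wedge (expand_det_col _ ord0); apply: eq_bigr => k _.
rewrite /cofactor !mxE addn0 /= -det_map_mx mulrCA.
do 2 congr (_ * _); congr (\det _).
by apply/matrixP => x y; rewrite !mxE rmorphXn /= /skip msubstX.
Qed.

Hypothesis muN : forall z, mu (- z) = - mu z.

(* The term of [boundary_wedge] at [r < s], up to its sign; it makes sense for
   all [r] and [s] and is antisymmetric in them. *)
Let G I (r s : nat) : {mpoly rat[n.+1]} :=
  (mu ((nth 0%N I s)%:Z - (nth 0%N I r)%:Z))%:~R *: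
    wedge n.+1 ((nth 0%N I r + nth 0%N I s)%N :: wedge_minor I r s).

Let G_antisym I r s : G I s r = - G I r s.
Proof.
rewrite /G -opprB muN rmorphN scaleNr addnC; congr (- (_ *: wedge _ (_ :: _))).
by congr map; apply: eq_filter => k; rewrite andbC.
Qed.

Let G_diag I r : G I r r = 0.
Proof.
have /eqP := G_antisym I r r.
by rewrite -addr_eq0 -mulr2n -scaler_nat scaler_eq0 /= => /eqP.
Qed.

Lemma alternating_merge_weight_wedge I :
  \sum_(k < n.+1) (-1) ^+ k * merge k (weight (wedge n.+2 I)) =
  \sum_(r < n.+2) \sum_(s < n.+1) (-1) ^+ (r + s) * G I r (lift r s).
Proof.
rewrite wedge_expand2.
transitivity (\sum_(k < n.+1) \sum_(r < n.+2) \sum_(s < n.+1)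
    (-1) ^+ k * (merge k \o weight) ((-1) ^+ (r + s) *
      ('X_ord0 ^+ nth 0%N I r * 'X_i1 ^+ nth 0%N I (lift r s)
       * shift2 (wedge n (wedge_minor I r (lift r s)))))).
  apply: eq_bigr => k _;
    rewrite -[merge k (weight _)]/((merge k \o weight) _) raddf_sum mulr_sumr.
  by apply: eq_bigr => r _; rewrite raddf_sum mulr_sumr.
rewrite /=.
rewrite exchange_big; apply: eq_bigr => r _ /=.
rewrite exchange_big; apply: eq_bigr => s _ /=.
rewrite /G wedge_expand1 scaler_sumr [RHS]mulr_sumr; apply: eq_bigr => k _.
have sgn p (F : {mpoly rat[p]}) : (-1) ^+ (r + s) * F = (-1) ^+ (r + s) *: F.
  by rewrite -mul_mpolyC rmorphXn /= mpolyCN mpolyC1.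
rewrite !sgn linearZ /= weight_shift2 -!mul_mpolyC.
rewrite !rmorphM /= !rmorphXn /= merge_shift2.
rewrite !mergeC !mergeX merge_idx0 merge_idx1.
rewrite (exprD 'X_k); set u := _%:MP ^+ _; set v := _%:MP.
by rewrite mulrCA; congr (u * _); rewrite mulrCA.
Qed.

(** The factor 2 arises because the Laplace expansion runs over ordered pairs
    of positions, and the boundary over unordered ones. *)
Lemma boundary_wedge_merge I :
  boundary_wedge mu n.+2 I *+ 2 =
  \sum_(k < n.+1) (-1) ^+ k * merge k (weight (wedge n.+2 I)).
Proof.
rewrite alternating_merge_weight_wedge.
(* The sign of the Laplace expansion at the columns [r] and [s], where for
   [s > r] the column [s] is [lift r (s - 1)]. *)
pose e (r s : nat) : {mpoly rat[n.+1]} := (-1) ^+ (r + s + (r < s)%N).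
transitivity (\sum_(r < n.+2) \sum_(s < n.+2) e r s * G I r s); last first.
  apply: eq_bigr => r _; rewrite (bigD1_ord r) //= G_diag mulr0 add0r.
  apply: eq_bigr => s _; congr (_ * _); rewrite /e /= /bump.
  case: (leqP r s) => [rs|sr]; last by rewrite add0n ltnNge (ltnW sr) addn0.
  by rewrite add1n ltnS rs addn1 addnS !exprS !mulN1r opprK.
have E : boundary_wedge mu n.+2 I =
    \sum_(r < n.+2) \sum_(s < n.+2 | (r < s)%N) e r s * G I r s.
  apply: eq_bigr => r _; apply: eq_bigr => s rs.
  rewrite -scalerA /e rs -[RHS]mulr1 -/(G I r s) -mul_mpolyC.
  by rewrite rmorphXn /= mpolyCN mpolyC1 mulr1.
rewrite E; symmetry.
apply: (@sum_sym_ltn _ _ (fun r s => e r s * G I r s)) => [r s|r]; last first.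
  by rewrite G_diag mulr0.
rewrite G_antisym /e [(s + r)%N]addnC; have [rs|sr|->] := ltngtP r s.
- by rewrite addn0 addn1 exprS; ring.
- by rewrite addn0 addn1 exprS; ring.
by rewrite G_diag oppr0.
Qed.

Lemma boundary_merge F : is_chain F ->
  boundary mu F *+ 2 = \sum_(k < n.+1) (-1) ^+ k * merge k (weight F).
Proof.
move=> cF; rewrite [in RHS](chain_wedgeE cF) /boundary -sumrMnl.
transitivity (\sum_(k < n.+1) \sum_(m <- msupp F | sorted ltn m)
    (-1) ^+ k * (merge k \o weight) (F@_m *: wedge n.+2 m)).
  rewrite exchange_big /=; apply: eq_bigr => m _.
  rewrite scalerMnr boundary_wedge_merge scaler_sumr; apply: eq_bigr => k _.
  by rewrite linearZ /= -!mul_mpolyC rmorphM /= mergeC mulrCA.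
apply: eq_bigr => k _; rewrite -[merge k (weight _)]/((merge k \o weight) _).
by rewrite raddf_sum mulr_sumr.
Qed.

Lemma merge_weight_eq0_boundary F : is_chain F ->
  (forall k, merge k (weight F) = 0) -> boundary mu F = 0.
Proof.
move=> cF F0; have /eqP := boundary_merge cF.
rewrite big1 => [|k _]; last by rewrite F0 mulr0.
by rewrite -scaler_nat scaler_eq0 /= => /eqP.
Qed.

End Boundary.

(** * Stability separates the merged chains *)

(** Invertibility of the Vandermonde system, through Lagrange interpolation. *)
Lemma power_sums_eq0 (R : idomainType) n (x h : 'I_n -> R) : injective x ->
  (forall e, \sum_k x k ^+ e * h k = 0) -> forall k, h k = 0.
Proof.
move=> xI E k; pose p := \prod_(l | l != k) ('X - (x l)%:P).
have Ep : \sum_l p.[x l] * h l = 0.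
  under eq_bigr => l _ do rewrite horner_coef mulr_suml.
  rewrite exchange_big big1 //= => e _.
  under eq_bigr => l _ do rewrite -mulrA.
  by rewrite -mulr_sumr E mulr0.
have px l : p.[x l] = \prod_(l' | l' != k) (x l - x l').
  by rewrite horner_prod; apply: eq_bigr => l' _; rewrite !hornerE.
move: Ep; rewrite (bigD1 k) //= big1 ?addr0 => [|l lk]; last first.
  by rewrite px (bigD1 l) //= subrr !mul0r.
move/eqP; rewrite mulf_eq0 px => /orP[|/eqP//].
rewrite prodf_seq_eq0 => /hasP[l _] /andP[lk].
by rewrite subr_eq0 inj_eq // eq_sym (negPf lk).
Qed.

Lemma mpolyX_inj (R : nzRingType) n :
  injective (fun k : 'I_n => 'X_k : {mpoly R[n]}).
Proof.
move=> k l /(congr1 (mcoeff U_(k))); rewrite !mcoeffXU eqxx.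
by case: eqP => // _ /eqP; rewrite oner_eq0.
Qed.

Lemma mpolyX_neq0 (R : nzRingType) n (k : 'I_n) : 'X_k != 0 :> {mpoly R[n]}.
Proof.
apply/eqP => /(congr1 (mcoeff U_(k))); rewrite mcoeffXU eqxx mcoeff0.
by move/eqP; rewrite oner_eq0.
Qed.

Lemma iter_sigma q r (F : {mpoly rat[q]}) :
  iter r (@sigma q) F = (\prod_(i < q) 'X_i) ^+ r * F.
Proof.
by elim: r => [|r IHr]; rewrite ?mul1r // iterS IHr /sigma exprS mulrA.
Qed.

Lemma is_chain_iter_sigma q r (F : {mpoly rat[q]}) :
  is_chain F -> is_chain (iter r (@sigma q) F).
Proof.
move=> cF s; rewrite iter_sigma rmorphM rmorphXn rmorph_prod /= cF -scalerAr.
congr (_ *: (_ ^+ _ * _)); rewrite [RHS](reindex_inj (@perm_inj _ s)).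
by apply: eq_bigr => i _; rewrite /msym mmapX mmap1U.
Qed.

Section Stability.

Variables (mu : int -> int) (n : nat).

Lemma weight_sigma (F : {mpoly rat[n.+2]}) :
  weight mu ((\prod_i 'X_i) * F) = (\prod_i 'X_i) * weight mu F.
Proof.
elim/mpoly_monomial_ind: F => [F G EF EG | c m].
  by rewrite mulrDr !raddfD /= mulrDr EF EG.
have -> : \prod_(i < n.+2) 'X_i = 'X_[\sum_i U_(i)] :> {mpoly rat[n.+2]}.
  by rewrite (big_morph _ (mpolyXD _) (mpolyX0 _ _)).
rewrite -scalerAr -mpolyXD !linearZ /= !weightX -!scalerAr -mpolyXD.
congr (_ *: (_ *: _)); rewrite /weight_mnm !mnmDE.
have S (k : 'I_n.+2) : (\sum_i U_(i) : 'X_{1..n.+2})%MM k = 1%N.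
  rewrite mnm_sumE (bigD1 k) //= big1 ?mnm1E ?eqxx // => l lk.
  by rewrite mnm1E (negPf lk).
by rewrite !S; congr ((mu _)%:~R); rewrite !PoszD; ring.
Qed.

Lemma merge_weight_iter_sigma k r (F : {mpoly rat[n.+2]}) :
  merge k (weight mu (iter r (@sigma _) F)) =
    ('X_k * \prod_i 'X_i) ^+ r * merge k (weight mu F).
Proof.
have E : merge k (\prod_i 'X_i) = 'X_k * \prod_i 'X_i :> {mpoly rat[n.+1]}.
  rewrite rmorph_prod 2!big_ord_recl /= !mergeX merge_idx0 merge_idx1.
  rewrite (bigD1_ord k) //=; congr (_ * (_ * _)).
  by apply: eq_bigr => l _; rewrite mergeX merge_idx2.
elim: r => [|r IHr]; first by rewrite mul1r.
by rewrite iterS {1}/sigma weight_sigma rmorphM /= E IHr exprS mulrA.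
Qed.

Hypothesis muN : forall z, mu (- z) = - mu z.

Lemma stable_cycle_mergeP (F : {mpoly rat[n.+2]}) : is_chain F ->
  stable_cycle mu F <-> forall k, merge k (weight mu F) = 0.
Proof.
move=> cF; split=> [sF k|F0 r]; last first.
  apply: merge_weight_eq0_boundary => [//||k]; first exact: is_chain_iter_sigma.
  by rewrite merge_weight_iter_sigma F0 mulr0.
suff /(_ k)/eqP : forall k : 'I_n.+1, (-1) ^+ k * merge k (weight mu F) = 0.
  by rewrite mulf_eq0 signr_eq0 => /eqP.
move=> {k}; apply: (power_sums_eq0 (@mpolyX_inj rat n.+1)) => e.
have := boundary_merge muN (is_chain_iter_sigma e cF).
rewrite sF mul0rn => /esym.
under eq_bigr => k _.
  rewrite merge_weight_iter_sigma exprMn mulrCA -mulrA mulrCA; over.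
rewrite -mulr_sumr => /eqP; rewrite mulf_eq0 expf_eq0 => /orP[/andP[_]|].
  by rewrite prodf_seq_eq0 => /hasP[l _]; rewrite (negPf (mpolyX_neq0 _ _)).
by move/eqP.
Qed.

End Stability.

(** * Chains and the variables 0 and 1 *)

Lemma msymXU q (s : 'S_q) k : msym s 'X_k = 'X_(s k) :> {mpoly rat[q]}.
Proof. by rewrite /msym mmapX mmap1U. Qed.

Lemma msymC q (s : 'S_q) c : msym s c%:MP = c%:MP :> {mpoly rat[q]}.
Proof. by rewrite /msym mmapC. Qed.

Lemma mu_L0N z : mu_L0 (- z) = - mu_L0 z.
Proof. by []. Qed.

Lemma mu_calL0_mod z w : (z = w %[mod 3])%Z -> mu_calL0 z = mu_calL0 w.
Proof. by rewrite /mu_calL0 => ->. Qed.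

Lemma mu_calL0N z : mu_calL0 (- z) = - mu_calL0 z.
Proof.
rewrite -(mu_calL0_mod (modzNm z 3)) -[in RHS](mu_calL0_mod (modz_mod z 3)).
have := modz_ge0 z (isT : 3 != 0 :> int).
have := ltz_pmod z (isT : 0 < 3 :> int).
by case: (z %% 3)%Z => [[|[|[|]]]|].
Qed.

(** In terms of a primitive cube root of unity [c], the structure constant
    at [z] is [(c ^ z - c ^ (- z)) / (c - c ^ (- 1))]. *)
Lemma mu_calL0_cube_root (c : algC) a b : c ^+ 2 + c + 1 = 0 ->
  (c - c ^+ 2) * (mu_calL0 (b%:Z - a%:Z))%:~R =
    c ^+ (2 * a + b) - (c ^+ 2) ^+ (2 * a + b).
Proof.
move=> c3; have c31 := cube_root_cube c3; set e := (2 * a + b)%N.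
(* Indeed [2 a + b] is congruent to [b - a] modulo 3. *)
have -> : mu_calL0 (b%:Z - a%:Z) = mu_calL0 (e %% 3)%N.
  apply: mu_calL0_mod; rewrite -modz_nat modz_mod /e PoszD PoszM.
  by rewrite -[RHS](modzMDl (- a%:Z)); congr (_ %% _)%Z; ring.
rewrite -!exprM -[in RHS](expr_mod e c31) mulnC exprM -(expr_mod e c31) -exprM.
have : (e %% 3 < 3)%N by rewrite ltn_mod.
case: (e %% 3)%N => [|[|[|]]] // _.
- by rewrite mulr0 subrr.
- by rewrite mulr1.
rewrite -[mu_calL0 _]/(- 1) mulrN1z; have -> : c ^+ (2 * 2) = c.
  by rewrite (exprD c 3 1) c31 mul1r.
by ring.
Qed.

Section FirstPair.

Variable n : nat.
Implicit Types F G : {mpoly rat[n.+2]}.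

Let i0 : 'I_n.+2 := ord0.
Let i1 : 'I_n.+2 := lift ord0 ord0.

Lemma lift_merge_idx l : lift i1 (merge_idx ord0 l) = collapse_idx i1 i0 l.
Proof.
rewrite /collapse_idx /i1; case: (unliftP ord0 l) => [l1 ->|->].
  case: (unliftP ord0 l1) => [l2 ->|->].
    rewrite merge_idx2 (inj_eq lift_inj) [_ == ord0]eq_sym.
    by rewrite (negPf (neq_lift _ _)); apply/val_inj.
  by rewrite merge_idx1 eqxx; apply/val_inj.
by rewrite merge_idx0; apply/val_inj.
Qed.

Lemma merge_idx_eq0 l : (merge_idx ord0 l == ord0) = (l == i0) || (l == i1).
Proof.
rewrite /i1; case: (unliftP ord0 l) => [l1 ->|->]; last by rewrite merge_idx0.
case: (unliftP ord0 l1) => [l2 ->|->]; last by rewrite merge_idx1 !eqxx orbT.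
rewrite merge_idx2 (inj_eq lift_inj) ![lift _ _ == _]eq_sym.
by rewrite !(negPf (neq_lift _ _)).
Qed.

Lemma collapse_merge0 F : merge ord0 F = 0 -> collapse i1 i0 F = 0.
Proof.
pose u : {mpoly rat[n.+1]} -> {mpoly rat[n.+2]} :=
  msubst (fun l => 'X_(lift i1 l)).
move=> F0; suff -> : collapse i1 i0 F = u (merge ord0 F).
  by rewrite F0 /u rmorph0.
apply: (@mpoly_rmorph_eq _ _ _ (collapse i1 i0)
  (msubst (fun l => 'X_(lift i1 l)) \o merge ord0)) => [c|l] /=.
  by rewrite mergeC /collapse !msubstC.
by rewrite mergeX collapseX msubstX lift_merge_idx.
Qed.

Lemma collapse_antisym F : msym (tperm i0 i1) F = - F -> collapse i1 i0 F = 0.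
Proof.
have C : collapse i1 i0 (msym (tperm i0 i1) F) = collapse i1 i0 F.
  move: F; apply: (@mpoly_rmorph_eq _ _ _
    (collapse i1 i0 \o msym (tperm i0 i1)) (collapse i1 i0)) => [c|l] /=.
    by rewrite msymC.
  rewrite msymXU !collapseX; congr 'X_(_); rewrite /collapse_idx.
  by case: tpermP => [->|->|]; rewrite // !eqxx; case: eqP.
move=> E; move: C; rewrite E rmorphN /= => /esym/eqP.
by rewrite -addr_eq0 -mulr2n -scaler_nat scaler_eq0 /= => /eqP.
Qed.

Lemma chain_tperm F : is_chain F -> msym (tperm i0 i1) F = - F.
Proof. by move=> ->; rewrite odd_tperm /= scaleN1r. Qed.

(** * The factor for the algebra [L_0] *)

(** [weight mu_L0] is the derivation ['X_1 d/d'X_1 - 'X_0 d/d'X_0]. *)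
Lemma weightM F G : weight mu_L0 (F * G) =
  weight mu_L0 F * G + F * weight mu_L0 G.
Proof.
elim/mpoly_monomial_ind: F => [F F' EF EF' | c m].
  by rewrite !(mulrDl, raddfD) /= EF EF'; ring.
elim/mpoly_monomial_ind: G => [G G' EG EG' | d k].
  by rewrite !(mulrDr, raddfD) /= EG EG'; ring.
rewrite -!mul_mpolyC mulrACA -mpolyXD -mpolyCM !mul_mpolyC !linearZ /=.
rewrite !weightX -!mul_mpolyC mpolyCM mpolyXD.
suff -> : weight_mnm mu_L0 (m + k) = weight_mnm mu_L0 m + weight_mnm mu_L0 k.
  by rewrite mpolyCD; ring.
rewrite /weight_mnm /mu_L0 !mnmDE !PoszD -intrD; congr (_ *~ _); ring.
Qed.

Let p : {mpoly rat[n.+2]} := 'X_i1 - 'X_i0.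

Let p_neq0 : p != 0.
Proof.
have := @mpolyXn_sub_neq0 rat _ i1 i0 1 isT isT.
by rewrite !expr1.
Qed.

Let merge_p k : merge k p = 0.
Proof. by rewrite rmorphB /= !mergeX merge_idx0 merge_idx1 subrr. Qed.

Lemma weight_p : weight mu_L0 p = 'X_i1 + 'X_i0.
Proof.
rewrite raddfB /= !weightX /weight_mnm /mu_L0 !mnm1E !eqxx /=.
by rewrite scale1r scaleN1r opprK.
Qed.

Lemma merge_weight_cube_dvd F k : rdvd (p ^+ 3) F ->
  merge k (weight mu_L0 F) = 0.
Proof.
case=> G ->; move: (merge_p k); move: (p) => u u0.
rewrite !exprS expr0 mulr1 !weightM !(rmorphD, rmorphM) /= u0.
move: (merge k G) (merge k (weight _ G)) (merge k (weight _ u)) => x y z.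
by rewrite !(mulr0, mul0r, addr0).
Qed.

Lemma cube_dvd_merge_weight F : is_chain F ->
  merge ord0 (weight mu_L0 F) = 0 -> rdvd (p ^+ 3) F.
Proof.
move=> cF F0; have [G EG] : rdvd p F.
  by apply/rdvd_collapse/collapse_antisym/chain_tperm.
(* Modulo [p], [weight mu_L0 F] is [G * weight mu_L0 p], and [weight mu_L0 p]
   specializes to twice a variable. *)
have [H EH] : rdvd p G.
  apply: rdvd_collapse; apply: collapse_merge0.
  move: F0 (merge_p ord0); rewrite EG weightM weight_p; move: (p) => u.
  rewrite !(rmorphD, rmorphM) /= => + u0.
  rewrite u0 !mergeX merge_idx0 merge_idx1 mulr0 add0r => /eqP.
  rewrite mulf_eq0 -mulr2n -scaler_nat scaler_eq0 /=.
  by rewrite (negPf (mpolyX_neq0 _ _)) orbF => /eqP.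
have {}EG : F = H * p ^+ 2 by rewrite EG EH -/p; ring.
(* [H] is antisymmetric, since [F] is and [p ^ 2] is symmetric. *)
have [K EK] : rdvd p H.
  apply: rdvd_collapse.
  have Mp : msym (tperm i0 i1) p = - p.
    by rewrite rmorphB /= !msymXU tpermL tpermR opprB.
  apply: collapse_antisym; apply: (mulIf (expf_neq0 2 p_neq0)).
  by rewrite mulNr -EG -(chain_tperm cF) EG rmorphM rmorphXn /= Mp sqrrN.
by exists K; rewrite EG EK -/p; ring.
Qed.

(** * The factor for the algebra with structure constants modulo 3 *)

Section CubeRoot.

Variable c : algC.
Hypothesis c3 : c ^+ 2 + c + 1 = 0.

(** The scalars of the substitution [Cmerge] below. *)
Definition twist (w : algC) (l : 'I_n.+2) : algC :=
  if l == i0 then w ^+ 2 else if l == i1 then w else 1.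

(** The substitution ['X_0 := w ^ 2 'X_k] and ['X_1 := w 'X_k], with the
    renaming of [merge k] on the other variables. *)
Definition Cmerge (w : algC) (k : 'I_n.+1) :
    {mpoly rat[n.+2]} -> {mpoly algC[n.+1]} :=
  Csubst (fun l => twist w l *: 'X_(merge_idx k l)).

HB.instance Definition _ w k := GRing.RMorphism.on (Cmerge w k).

Lemma CmergeX w k l : Cmerge w k 'X_l = twist w l *: 'X_(merge_idx k l).
Proof. exact: CsubstX. Qed.

Lemma CmergeC w k a : Cmerge w k a%:MP = (ratr a)%:MP.
Proof. exact: CsubstC. Qed.

Lemma Cmerge_monomial w k m : Cmerge w k 'X_[m] =
  w ^+ (2 * m i0 + m i1) *: map_mpoly ratr (merge k 'X_[m]).
Proof.
rewrite /Cmerge /Csubst /merge /msubst !mmapX /mmap1 rmorph_prod.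
transitivity (\prod_(l < n.+2) (twist w l ^+ m l *: 'X_(merge_idx k l) ^+ m l)
    : {mpoly algC[n.+1]}).
  by apply: eq_bigr => l _; rewrite exprZn.
rewrite scaler_prod; congr (_ *: _).
  rewrite 2!big_ord_recl big1 => [|l _]; last first.
    by rewrite /twist !(inj_eq lift_inj) /= expr1n.
  by rewrite /twist !eqxx /= mulr1 exprD exprM.
by apply: eq_bigr => l _; rewrite rmorphXn /= map_mpolyX.
Qed.

Lemma merge_weight_cube_root F k :
  (c - c ^+ 2) *: map_mpoly ratr (merge k (weight mu_calL0 F)) =
    Cmerge c k F - Cmerge (c ^+ 2) k F.
Proof.
elim/mpoly_monomial_ind: F => [F G EF EG | a m].
  by rewrite [weight _ _]raddfD !rmorphD /= scalerDr opprD addrACA;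
    congr (_ + _).
rewrite linearZ /= weightX -!mul_mpolyC !rmorphM /= !mergeC !map_mpolyC.
rewrite !CmergeC !Cmerge_monomial -!mul_mpolyC.
have /(congr1 (@mpolyC n.+1 algC)) := mu_calL0_cube_root (m i0) (m i1) c3.
rewrite mpolyCM => E.
rewrite -[RHS]mulrBr -mulrBl -mpolyCB -E /weight_mnm rmorph_int.
by ring.
Qed.

Lemma Cmerge_swap w F k : w ^+ 3 = 1 ->
  Cmerge w k (msym (tperm i0 i1) F) = Cmerge (w ^+ 2) k F.
Proof.
move=> w3; move: F; apply: (@mpoly_rmorph_eq _ _ _
  (Cmerge w k \o msym (tperm i0 i1)) (Cmerge (w ^+ 2) k)) => [a|l] /=.
  by rewrite msymC !CmergeC.
rewrite msymXU !CmergeX /twist; case: tpermP => [->|->|].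
- by rewrite !eqxx /= merge_idx0 merge_idx1 -exprM (exprD w 3 1) w3 mul1r.
- by rewrite !eqxx /= merge_idx0 merge_idx1.
by move=> /eqP/negPf-> /eqP/negPf->.
Qed.

Lemma Cmerge_cube w k : w ^+ 3 = 1 ->
  Cmerge w k ('X_i1 ^+ 3 - 'X_i0 ^+ 3) = 0.
Proof.
move=> w3; rewrite rmorphB !rmorphXn /= !CmergeX merge_idx0 merge_idx1 !exprZn.
by rewrite /twist !eqxx /= exprAC w3 expr1n subrr.
Qed.

Let c_neq : c - c ^+ 2 != 0.
Proof.
rewrite subr_eq0; apply/eqP => cE.
have c1 : c = 1 by rewrite -(cube_root_cube c3) exprS -cE -expr2 -cE.
by move: c3; rewrite c1 expr1n => /eqP;
  rewrite -(natrD _ 1 1) -(natrD _ 2 1) Num.Theory.pnatr_eq0.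
Qed.

Lemma merge_weight_sub_cube_dvd F k : rdvd ('X_i1 ^+ 3 - 'X_i0 ^+ 3) F ->
  merge k (weight mu_calL0 F) = 0.
Proof.
have c31 := cube_root_cube c3.
case=> G EG; have := merge_weight_cube_root F k.
rewrite {2 3}EG !rmorphM /= !Cmerge_cube // 1?exprAC ?c31 ?expr1n //.
rewrite !mulr0 subrr => /eqP; rewrite scaler_eq0 (negPf c_neq) /= => /eqP E.
apply/mpolyP => m; apply: (@fmorph_inj _ _ (@ratr algC)).
by rewrite -mcoeff_map_mpoly E !mcoeff0 rmorph0.
Qed.

Lemma sub_cube_dvd_merge_weight F : is_chain F ->
  merge ord0 (weight mu_calL0 F) = 0 -> rdvd ('X_i1 ^+ 3 - 'X_i0 ^+ 3) F.
Proof.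
move=> cF F0; have c31 := cube_root_cube c3.
have E0 : Cmerge c ord0 F = 0.
  have := merge_weight_cube_root F ord0.
  rewrite F0 rmorph0 scaler0 -Cmerge_swap // (chain_tperm cF) rmorphN /= opprK.
  move=> /esym/eqP; rewrite -mulr2n -scaler_nat scaler_eq0.
  by rewrite Num.Theory.pnatr_eq0 /= => /eqP.
have c23 : (c ^+ 2) ^+ 2 + c ^+ 2 + 1 = 0.
  by rewrite -exprM (exprD c 3 1) c31 mul1r expr1 [c + _]addrC.
(* Rescaling by [c] turns the point [(c ^ 2 'X_0, c 'X_0)] into
   [('X_0, c ^ 2 'X_0)]. *)
have [|G EG] := @rdvd_Ccollapse _ i1 i0 _ c23 F isT.
  pose u : {mpoly algC[n.+1]} -> {mpoly algC[n.+2]} :=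
    msubst (fun l => (if l == ord0 then c else 1) *: 'X_(lift i1 l)).
  suff -> : Ccollapse i1 i0 (c ^+ 2) F = u (Cmerge c ord0 F).
    by rewrite E0 /u rmorph0.
  apply: (@mpoly_rmorph_eq _ _ _ (Ccollapse i1 i0 (c ^+ 2))
    (msubst (fun l => (if l == ord0 then c else 1) *: 'X_(lift i1 l))
       \o Cmerge c ord0)) => [a|l] /=.
    by rewrite CmergeC /Ccollapse CsubstC msubstC.
  rewrite CmergeX -mul_mpolyC rmorphM /= msubstC msubstX lift_merge_idx.
  rewrite mul_mpolyC scalerA /Ccollapse CsubstX /collapse_idx /twist.
  have [->|l1] := eqVneq l i1; first by rewrite /= merge_idx1 eqxx -expr2.
  have [->|l0] := eqVneq l i0.
    by rewrite merge_idx0 eqxx -exprSr c31 scale1r.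
  suff -> : (merge_idx ord0 l == ord0) = false by rewrite mulr1 scale1r.
  by rewrite merge_idx_eq0 (negPf l0) (negPf l1).
have [H EH] : rdvd ('X_i1 - 'X_i0) G.
  apply: rdvd_collapse; have := collapse_antisym (chain_tperm cF).
  rewrite EG rmorphM /= => /eqP; rewrite mulf_eq0 => /orP[/eqP//|].
  rewrite /cyclo3 !(rmorphD, rmorphM, rmorphXn) /= !collapseX.
  rewrite /collapse_idx eqxx /= -expr2 -mulr2n -mulrSr -scaler_nat scaler_eq0.
  by rewrite expf_eq0 (negPf (mpolyX_neq0 _ _)).
by exists H; rewrite EG EH cube_sub_factor mulrA.
Qed.

End CubeRoot.

End FirstPair.

(** * From one pair of variables to all pairs *)

Lemma perm_pair_exists (T : finType) (x y i j : T) : x != y -> i != j ->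
  exists s : {perm T}, s x = i /\ s y = j.
Proof.
move=> xy ij; exists (tperm x (tperm y j i) * tperm y j)%g.
rewrite !permM tpermL tpermK; split=> //.
rewrite [tperm x _ y]tpermD ?tpermL //; apply: contraNneq ij.
by move/(congr1 (tperm y j)); rewrite tpermK tpermL => ->.
Qed.

Section AllPairs.

Variable n : nat.
Let i0 : 'I_n.+2 := ord0.
Let i1 : 'I_n.+2 := lift ord0 ord0.

(* The factor [b i j] belongs to the pair of variables [i] and [j]. *)
Variable b : 'I_n.+2 -> 'I_n.+2 -> {mpoly rat[n.+2]}.
Hypothesis b_perm : forall s i j, msym s (b i j) = b (s i) (s j).
Hypothesis b_regular : forall i j k l : 'I_n.+2,
  (j < i)%N -> (l < k)%N -> (k, l) != (i, j) -> regular_mod (b k l) (b i j).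

Lemma rdvd_chain_pair F (i j : 'I_n.+2) : is_chain F -> i != j ->
  rdvd (b i1 i0) F -> rdvd (b i j) F.
Proof.
move=> cF ij [G EG]; have [s [s1 s0]] := perm_pair_exists (isT : i1 != i0) ij.
exists ((-1) ^+ s *: msym s G); rewrite -scalerAl -s1 -s0 -b_perm -rmorphM /=.
by rewrite -EG cF scalerA -signr_addb addbb scale1r.
Qed.

Lemma rdvd_chain_prod F : is_chain F ->
  rdvd (b i1 i0) F <->
    rdvd (\prod_(i < n.+2) \prod_(j < n.+2 | (j < i)%N) b i j) F.
Proof.
move=> cF; split=> [bF|[G ->]]; last first.
  rewrite (bigD1 i1) //= (bigD1 i0) //= -mulrA mulrCA.
  by exists (G * (\prod_(j < n.+2 | (j < 1)%N && (j != i0)) b i1 j *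
    \prod_(i < n.+2 | i != i1) \prod_(j < n.+2 | (j < i)%N) b i j)); ring.
rewrite pair_big_dep /= -big_filter; apply: rdvd_prod.
- by rewrite filter_uniq ?index_enum_uniq.
- move=> [k l] [i j]; rewrite !mem_filter /= => /andP[lk _] /andP[ji _].
  exact: b_regular.
move=> [i j]; rewrite mem_filter /= => /andP[ji _].
by apply: rdvd_chain_pair; rewrite // neq_ltn ji orbT.
Qed.

End AllPairs.

(** In fewer than two variables every chain is a stable cycle. *)
Lemma boundary_small mu q (F : {mpoly rat[q]}) : (q < 2)%N -> boundary mu F = 0.
Proof.
move=> q2; rewrite /boundary big1 // => m _.
rewrite /boundary_wedge big1 ?scaler0 //.
move=> r _; rewrite big_pred0 // => s; apply: contraTF q2 => rs.
by rewrite -leqNgt (leq_ltn_trans (leq_ltn_trans (leq0n r) rs) (ltn_ord s)).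
Qed.

Lemma vandermonde_small q (t : 'I_q -> {mpoly rat[q]}) :
  (q < 2)%N -> vandermonde t = 1.
Proof.
move=> q2; rewrite /vandermonde big1 // => i _.
rewrite big_pred0 // => j; apply: contraTF q2 => ji; rewrite -leqNgt.
exact: leq_ltn_trans (leq_ltn_trans (leq0n j) ji) (ltn_ord i).
Qed.

Theorem theorem7p1 :
  (forall (q : nat) (F : {mpoly rat[q]}), is_chain F ->
     (stable_cycle mu_L0 F <->
      exists G : {mpoly rat[q]},
        F = G * vandermonde (fun i : 'I_q => 'X_i) ^+ 3)) /\
  (forall (q : nat) (F : {mpoly rat[q]}), is_chain F ->
     (stable_cycle mu_calL0 F <->
      exists G : {mpoly rat[q]},
        F = G * vandermonde (fun i : 'I_q => 'X_i ^+ 3))).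
Proof.
have small mu q (F V : {mpoly rat[q]}) : (q < 2)%N -> V = 1 ->
    stable_cycle mu F <-> exists G, F = G * V.
  move=> q2 ->; split=> [_|_ r]; last exact: boundary_small.
  by exists F; rewrite mulr1.
split=> q F; case: (ltnP q 2) => [q2 _|].
- by apply: small; rewrite // vandermonde_small ?expr1n.
- case: q F => [|[|n]] // F _ cF.
  rewrite (stable_cycle_mergeP mu_L0N cF).
  pose b (i j : 'I_n.+2) : {mpoly rat[n.+2]} := ('X_i - 'X_j) ^+ 3.
  have -> : vandermonde (fun i : 'I_n.+2 => 'X_i) ^+ 3 =
      \prod_(i < n.+2) \prod_(j < n.+2 | (j < i)%N) b i j.
    by rewrite /vandermonde -prodrXl; apply: eq_bigr => i _; rewrite -prodrXl.
  have [|i j k l ji lk kl|div1 div2] := @rdvd_chain_prod n b _ _ F cF.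
  + by move=> s i j; rewrite rmorphXn rmorphB /= !msymXU.
  + exact: regular_mod_sub_cube.
  split=> [F0|/div2 bF k]; last exact: merge_weight_cube_dvd.
  by apply: div1; apply: cube_dvd_merge_weight.
- by apply: small; rewrite // vandermonde_small.
case: q F => [|[|n]] // F _ cF.
rewrite (stable_cycle_mergeP mu_calL0N cF).
pose b (i j : 'I_n.+2) : {mpoly rat[n.+2]} := 'X_i ^+ 3 - 'X_j ^+ 3.
have [|i j k l ji lk kl|div1 div2] := @rdvd_chain_prod n b _ _ F cF.
- by move=> s i j; rewrite rmorphB !rmorphXn /= !msymXU.
- exact: regular_mod_cube_sub.
have [c c3] := cube_root_exists.
split=> [F0|/div2 bF k]; last exact: (merge_weight_sub_cube_dvd c3).
by apply: div1; apply: (sub_cube_dvd_merge_weight c3).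
Qed.
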